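(* Let $\mathcal G=(\mathcal N,\mathcal E)$ be a connected undirected graph on $\mathcal N=\{1,\dots,N\}$, and for every $i\in\mathcal N$ let $F_i=\rho_i+\gamma_i$ with $\rho_i\in\mathcal R$ and $\gamma_i\in\Gamma$. Let $F^*=\min_{x\in\mathbb R^n}\sum_{i\in\mathcal N}F_i(x)$ and let $\{\mathbf x^{(k)}\}_{k\ge1}$, $\mathbf x^{(k)}=(x^{(k)}_i)_{i\in\mathcal N}$, denote the sequence of DFAL iterates for the consensus problem $$\min_{x_i\in\mathbb R^n,\ i\in\mathcal N}\Big\{\sum_{i=1}^N F_i(x_i):\ x_i=x_j\ \ \forall (i,j)\in\mathcal E\Big\}.$$ Then $F^*=\lim_{k\to\infty}\sum_{i\in\mathcal N}F_i(x^{(k)}_i)$. Furthermore, for every $\epsilon>0$, $\mathbf x^{(k)}$ is $\epsilon$-optimal and $\epsilon$-feasible within $\mathcal O(\log(\epsilon^{-1}))$ DFAL iterations, requiring $\mathcal O\big(\frac{\psi_{\max}^{1.5}}{d_{\min}}\,\epsilon^{-1}\big)$ communications per node and $\mathcal O(\epsilon^{-1})$ gradient and proximal map computations for $\gamma_i$ and $\rho_i$, respectively, where $\psi_{\max}$ denotes the largest eigenvalue of the Laplacian of $\mathcal G$ and $d_{\min}$ denotes the minimum degree over all nodes.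
   Context: **Function classes.** $\Gamma$ is the set of convex $\gamma:\mathbb R^n\to\mathbb R$ such that $\nabla\gamma$ is Lipschitz continuous with constant $L_\gamma$ and $\gamma(x)\ge\underline\gamma$ for all $x$, for some $\underline\gamma\in\mathbb R$. $\mathcal R$ is the set of convex $\rho:\mathbb R^n\to\mathbb R$ for which there are $B>0$ with $\|q\|_2\le B$ for all $q\in\partial\rho(x)$, $x\in\mathbb R^n$, and $\tau>0$ with $\tau\|x\|_2\le\rho(x)$ for all $x\in\mathbb R^n$. Constants for $\gamma_i,\rho_i$ are written $L_{\gamma_i},\underline{\gamma_i},B_i,\tau_i$; $\bar\tau=\min_i\tau_i$. The proximal map of $\rho$ is $\mathbf{prox}_\rho(x)=\arg\min_y\{\rho(y)+\frac12\|y-x\|_2^2\}$. **$\epsilon$-feasible / $\epsilon$-optimal.** $\bar{\mathbf x}=(\bar x_i)_{i}$ is $\epsilon$-feasible if $\max_{(i,j)\in\mathcal E}\|\bar x_i-\bar x_j\|_2\le\epsilon$, and $\epsilon$-optimal if $|\sum_iF_i(\bar x_i)-F^*|\le\epsilon$. **Matrix form.** Let $\Omega\in\mathbb R^{N\times N}$ be the Laplacian of $\mathcal G$ ($\Omega_{ii}=d_i$, the degree of $i$; $\Omega_{ij}=-1$ if $i\ne j$ are adjacent; $0$ otherwise). Orient each edge from smaller to larger index and let $C\in\mathbb R^{n|\mathcal E|\times nN}$ be the block matrix whose block row for edge $(i,j)$, $i<j$, has $I_n$ in block $i$, $-I_n$ in block $j$, and zeros elsewhere, so $C^\top C=\Omega\otimes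 I_n$. With reduced SVD $C=U\Sigma V^\top$ put $A=\Sigma V^\top\in\mathbb R^{n(N-1)\times nN}$ and $b=0$; then $A$ has full row rank, $A^\top A=\Omega\otimes I_n$, and $A\mathbf x=0$ iff $x_i=x_j$ for all $(i,j)\in\mathcal E$. **DFAL.** Let $\bar\rho(\mathbf x)=\sum_i\rho_i(x_i)$, $\bar\gamma(\mathbf x)=\sum_i\gamma_i(x_i)$, $c\in(0,1)$, and let $\lambda^{(1)},\alpha^{(1)},\xi^{(1)}>0$, $\theta^{(1)}=0$. For $k\ge1$ let $f^{(k)}(\mathbf x)=\lambda^{(k)}\bar\gamma(\mathbf x)+\frac12\|A\mathbf x-b-\lambda^{(k)}\theta^{(k)}\|_2^2$, $P^{(k)}=\lambda^{(k)}\bar\rho+f^{(k)}$, and $\mathbf x_*^{(k)}\in\arg\min P^{(k)}$. Iteration $k$: (1) compute $\mathbf x^{(k)}$ satisfying at least one of (a) $P^{(k)}(\mathbf x^{(k)})-P^{(k)}(\mathbf x^{(k)}_* )\le\alpha^{(k)}$; (b) there are $g_i^{(k)}\in\lambda^{(k)}\partial\rho_i(x_i^{(k)})+\nabla_{x_i}f^{(k)}(\mathbf x^{(k)})$, $i\in\mathcal N$, with $\max_i\|g^{(k)}_i\|_2\le\xi^{(k)}/\sqrt N$; (2) $\theta^{(k+1)}=\theta^{(k)}-(A\mathbf x^{(k)}-b)/\lambda^{(k)}$; (3) $\lambda^{(k+1)}=c\lambda^{(k)}$, $\alpha^{(k+1)}=c^2\alpha^{(k)}$, $\xi^{(k+1)}=c^2\xi^{(k)}$.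 It is assumed that $0<\lambda^{(1)}\le\bar\lambda$ and $\xi^{(1)}/\lambda^{(1)}<\bar\tau$, where $\bar\lambda>0$ is a constant (together with $B_x,B_\theta>0$) such that every such choice guarantees $\max\{\|\mathbf x_*^{(k)}\|_2,\|\mathbf x^{(k)}\|_2\}\le B_x$ and $\|\theta^{(k)}\|_2\le B_\theta$ for all $k\ge1$. **Inner solver and cost.** Step (1) is carried out by the multi-step accelerated proximal gradient method (MS-APG) started at $\mathbf y^{(0)}=\bar{\mathbf y}^{(1)}=\mathbf x^{(k-1)}$, $t^{(1)}=1$: for $\ell\ge1$, $y_i^{(\ell)}=\mathbf{prox}_{\lambda^{(k)}\rho_i/L_i^{(k)}}\big(\bar y_i^{(\ell)}-\nabla_{y_i}f^{(k)}(\bar{\mathbf y}^{(\ell)})/L_i^{(k)}\big)$ for all $i$, with $L_i^{(k)}=\lambda^{(k)}L_{\gamma_i}+\psi_{\max}$; $t^{(\ell+1)}=\frac12\big(1+\sqrt{1+4(t^{(\ell)})^2}\big)$; $\bar{\mathbf y}^{(\ell+1)}=\mathbf y^{(\ell)}+\frac{t^{(\ell)}-1}{t^{(\ell+1)}}(\mathbf y^{(\ell)}-\mathbf y^{(\ell-1)})$. It stops with $\mathbf x^{(k)}=\bar{\mathbf y}^{(\ell)}$ once $\bar{\mathbf y}^{(\ell)}$ satisfies (b), or otherwise with $\mathbf x^{(k)}=\mathbf y^{(\ell)}$ after $\ell^{(k)}_{\max}=B_x\sqrt{2\sum_iL_i^{(k)}/\alpha^{(k)}}$ (rounded up) iterations.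 Since $\nabla_{x_i}f^{(k)}(\mathbf x)=\lambda^{(k)}\nabla\gamma_i(x_i)+\sum_{j\in\mathcal N_i}\Omega_{ij}(x_j+\bar x_j^{(k)})$, where $\mathcal N_i$ consists of $i$ and its neighbours and $\bar{\mathbf x}^{(k)}=\sum_{t=1}^{k-1}\frac{\lambda^{(k)}}{\lambda^{(t)}}\mathbf x^{(t)}$, each MS-APG iteration costs each node one evaluation of $\nabla\gamma_i$, one proximal map of (a multiple of) $\rho_i$, and one exchange of an $n$-vector with its neighbours (one communication). The $\mathcal O(\cdot)$ notation hides factors independent of $\epsilon$. *)

(* Defs.v *)
From HB Require Import structures.
From mathcomp Require Export all_boot all_order all_algebra.
From mathcomp Require Export all_classical all_reals all_analysis.
From mathcomp Require Import mxtens.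
Export Order.TTheory GRing.Theory Num.Theory numFieldNormedType.Exports.

Set Implicit Arguments.
Unset Strict Implicit.
Unset Printing Implicit Defensive.

Local Open Scope classical_set_scope.
Local Open Scope ring_scope.

(* Points of R^n are row vectors; x = (x_1, ..., x_N) in R^{nN} is the N x n
   matrix x with x_i = row i x, and [stack x] is the same point as a column. *)

Section Euclidean.
Variable R : realType.

(* The library norm `|x| on matrices is the sup norm, whereas the Euclidean
   one is needed here. *)
Definition norm2 (m n : nat) (x : 'M[R]_(m, n)) : R :=
  Num.sqrt (\sum_i \sum_j x i j ^+ 2).

Definition dot (n : nat) (x y : 'rV[R]_n) : R := \sum_j x 0 j * y 0 j.

(* Block i of the gradient of f : R^{nm} -> R; for m = 1 and i = 0 this is the
   gradient of a function on R^n. *)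
Definition grad_block (m n : nat) (f : 'M[R]_(m, n) -> R) (i : 'I_m)
    (x : 'M[R]_(m, n)) : 'rV[R]_n :=
  \row_j 'D_(delta_mx i j) (f : 'M[R]_(m, n) -> R^o) x.

Definition grad (n : nat) (f : 'rV[R]_n -> R) : 'rV[R]_n -> 'rV[R]_n :=
  grad_block f 0.

Definition subdifferential (n : nat) (f : 'rV[R]_n -> R) (x : 'rV[R]_n) :
    set 'rV[R]_n :=
  [set q | forall y, f x + dot q (y - x) <= f y].

Definition is_argmin (T : Type) (f : T -> R) (x : T) : Prop :=
  forall y, f x <= f y.

Definition is_min (T : Type) (f : T -> R) (m : R) : Prop :=
  exists2 x, is_argmin f x & m = f x.

(* y = prox_rho(x); the argmin is a singleton for convex rho. *)
Definition is_prox (n : nat) (rho : 'rV[R]_n -> R) (x y : 'rV[R]_n) : Prop :=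
  is_argmin (fun z => rho z + 2^-1 * norm2 (z - x) ^+ 2) y.

Definition in_Gamma (n : nat) (L glow : R) (gamma : 'rV[R]_n -> R) : Prop :=
  [/\ convex_function setT gamma,
      forall x, differentiable (gamma : 'rV[R]_n -> R^o) x,
      0 <= L /\
        forall x y, norm2 (grad gamma x - grad gamma y) <= L * norm2 (x - y)
    & forall x, glow <= gamma x].

Definition in_Rclass (n : nat) (B tau : R) (rho : 'rV[R]_n -> R) : Prop :=
  [/\ convex_function setT rho,
      0 < B /\ forall x q, q \in subdifferential rho x -> norm2 q <= B
    & 0 < tau /\ forall x, tau * norm2 x <= rho x].

Definition stack (N n : nat) (x : 'M[R]_(N, n)) : 'cV[R]_(N * n) :=
  \col_k x (mxtens_unindex k).1 (mxtens_unindex k).2.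

End Euclidean.

Section Graph.
Variables (R : realType) (N : nat) (e : rel 'I_N).

Definition connected_graph : Prop :=
  [/\ symmetric e, irreflexive e & forall i j, connect e i j].

Definition degree (i : 'I_N) : nat := #|[pred j | e i j]|.

(* Degrees are smaller than N, so the default value N is neutral. *)
Definition min_degree : nat := \big[minn/N]_(i < N) degree i.

Definition laplacian : 'M[R]_N :=
  \matrix_(i, j) (if i == j then (degree i)%:R else if e i j then -1 else 0).

Definition is_max_eigenvalue (M : 'M[R]_N) (a : R) : Prop :=
  eigenvalue M a /\ forall a', eigenvalue M a' -> a' <= a.

Definition edges : {set 'I_N * 'I_N} :=
  [set p : 'I_N * 'I_N | (p.1 < p.2)%N && e p.1 p.2].

Definition incidence : 'M[R]_(#|edges|, N) :=
  \matrix_(k, i) ((i == (enum_val k).1)%:R - (i == (enum_val k).2)%:R).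

Definition edge_matrix (n : nat) : 'M[R]_(#|edges| * n, N * n) :=
  incidence *t 1%:M.

(* A = S V^T for some reduced singular value decomposition C = U S V^T of the
   edge matrix C, S being the diagonal matrix with diagonal s. *)
Definition is_constraint_matrix (n : nat) (A : 'M[R]_(N.-1 * n, N * n)) :=
  exists (U : 'M[R]_(#|edges| * n, N.-1 * n)) (s : 'rV[R]_(N.-1 * n))
         (V : 'M[R]_(N * n, N.-1 * n)),
  [/\ U^T *m U = 1%:M, V^T *m V = 1%:M, forall k, 0 < s 0 k,
      edge_matrix n = U *m diag_mx s *m V^T & A = diag_mx s *m V^T].

End Graph.

Section Consensus.
Variables (R : realType) (N n : nat) (rho gamma : 'I_N -> 'rV[R]_n -> R).

Definition sum_obj (x : 'M[R]_(N, n)) : R :=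
  \sum_i (rho i (row i x) + gamma i (row i x)).

Definition common_obj (x : 'rV[R]_n) : R := \sum_i (rho i x + gamma i x).

Definition eps_feasible (e : rel 'I_N) (eps : R) (x : 'M[R]_(N, n)) : Prop :=
  forall i j, e i j -> norm2 (row i x - row j x) <= eps.

Definition eps_optimal (Fstar eps : R) (x : 'M[R]_(N, n)) : Prop :=
  `|sum_obj x - Fstar| <= eps.

End Consensus.

(* The sequence a, q a, q^2 a, ... indexed from 1. *)
Definition geometric_from1 (R : realType) (q a : R) (k : nat) : R :=
  iter k.-1 (fun u => q * u) a.

(* All sequences of iterates are indexed from 1, as in the algorithm; their
   value at 0 is irrelevant, except that x 0 is the initial point x^(0) of the
   first call to the inner solver. *)
Section DFAL.
Variables (R : realType) (N n m : nat) (A : 'M[R]_(m, N * n)).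
Variables (rho gamma : 'I_N -> 'rV[R]_n -> R).
Variables (c lam1 alpha1 xi1 : R).

Definition lam_ : nat -> R := geometric_from1 c lam1.
Definition alpha_ : nat -> R := geometric_from1 (c ^+ 2) alpha1.
Definition xi_ : nat -> R := geometric_from1 (c ^+ 2) xi1.

(* The right-hand side b of the constraint A x = b is 0. *)
Definition smooth_part (lam : R) (th : 'cV[R]_m) (x : 'M[R]_(N, n)) : R :=
  lam * (\sum_i gamma i (row i x))
    + 2^-1 * norm2 (A *m stack x - lam *: th) ^+ 2.

Definition aug_lagrangian (lam : R) (th : 'cV[R]_m) (x : 'M[R]_(N, n)) : R :=
  lam * (\sum_i rho i (row i x)) + smooth_part lam th x.

Definition small_subgradient (lam : R) (th : 'cV[R]_m) (xi : R)
    (x : 'M[R]_(N, n)) : Prop :=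
  exists g : 'I_N -> 'rV[R]_n, forall i,
    (exists2 q, q \in subdifferential (rho i) (row i x) &
       g i = lam *: q + grad_block (smooth_part lam th) i x) /\
    norm2 (g i) <= xi / Num.sqrt N%:R.

(* xs k is the chosen minimizer of the k-th subproblem. *)
Definition dfal (x xs : nat -> 'M[R]_(N, n)) (th : nat -> 'cV[R]_m) : Prop :=
  th 1%N = 0 /\
  forall k, (0 < k)%N ->
    let P := aug_lagrangian (lam_ k) (th k) in
    [/\ is_argmin P (xs k),
        P (x k) - P (xs k) <= alpha_ k \/
          small_subgradient (lam_ k) (th k) (xi_ k) (x k)
      & th k.+1 = th k - (lam_ k)^-1 *: (A *m stack (x k))].

Definition dfal_bounded (Bx Bth : R) (x xs : nat -> 'M[R]_(N, n))
    (th : nat -> 'cV[R]_m) : Prop :=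
  forall k, (0 < k)%N ->
    Num.max (norm2 (xs k)) (norm2 (x k)) <= Bx /\ norm2 (th k) <= Bth.

(* Only the triple (lam1, alpha1, xi1) in use is required to guarantee the
   bounds: no constants work for all alpha1 > 0 simultaneously, since a large
   alpha1 admits arbitrarily large x^(1). The second premise says that
   xi1 / lam1 is smaller than the minimum of the tau i. *)
Definition guarantees_bounds (tau : 'I_N -> R) (lambar Bx Bth : R) : Prop :=
  lam1 <= lambar -> (forall i, xi1 / lam1 < tau i) ->
  forall x xs th, dfal x xs th -> dfal_bounded Bx Bth x xs th.

(* psi is the largest eigenvalue of the Laplacian, L i the Lipschitz constant
   of the gradient of gamma i. *)
Variables (L : 'I_N -> R) (psi Bx : R).

Definition block_lip (k : nat) (i : 'I_N) : R := lam_ k * L i + psi.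

Definition max_inner (k : nat) : nat :=
  `|Num.ceil (Bx * Num.sqrt (2 * (\sum_i block_lip k i) / alpha_ k))|%N.

(* y and yb are the iterates y^(l) and \bar y^(l) of MS-APG in iteration k. *)
Definition msapg (x : nat -> 'M[R]_(N, n)) (th : nat -> 'cV[R]_m) (k : nat)
    (y yb : nat -> 'M[R]_(N, n)) (t : nat -> R) : Prop :=
  [/\ y 0%N = x k.-1, yb 1%N = x k.-1, t 1%N = 1 &
  forall l, (0 < l)%N ->
    [/\ forall i,
          is_prox (fun z => lam_ k / block_lip k i * rho i z)
            (row i (yb l) - (block_lip k i)^-1 *:
               grad_block (smooth_part (lam_ k) (th k)) i (yb l))
            (row i (y l)),
        t l.+1 = 2^-1 * (1 + Num.sqrt (1 + 4 * t l ^+ 2))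
      & yb l.+1 = y l + ((t l - 1) / t l.+1) *: (y l - y l.-1)]].

(* Iteration k of DFAL computes x k by ell k iterations of MS-APG. *)
Definition solved_by_msapg (x : nat -> 'M[R]_(N, n)) (th : nat -> 'cV[R]_m)
    (ell : nat -> nat) : Prop :=
  forall k, (0 < k)%N -> exists y yb t,
    let stop l := small_subgradient (lam_ k) (th k) (xi_ k) (yb l) in
    msapg x th k y yb t /\
    ([/\ (0 < ell k <= max_inner k)%N, stop (ell k),
         forall l, (0 < l < ell k)%N -> ~ stop l & x k = yb (ell k)] \/
     [/\ ell k = max_inner k,
         forall l, (0 < l <= max_inner k)%N -> ~ stop l & x k = y (ell k)]).

End DFAL.

(* Cost per node of the first K iterations of DFAL: each of the ell k
   iterations of MS-APG takes one exchange with the neighbours, one evaluation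
   of the gradient of gamma i and one proximal map of a multiple of rho i. *)
Definition communications (ell : nat -> nat) (K : nat) : nat :=
  (\sum_(1 <= k < K.+1) ell k)%N.
Definition gradient_evals (ell : nat -> nat) (K : nat) : nat :=
  (\sum_(1 <= k < K.+1) ell k)%N.
Definition prox_evals (ell : nat -> nat) (K : nat) : nat :=
  (\sum_(1 <= k < K.+1) ell k)%N.

(* Main.v *)
From HB Require Import structures.
Require Import Defs.
From mathcomp Require Import mxtens ring lra.

(** Every DFAL subproblem is solved to an accuracy of order [lam_k ^ 2], because
    [alpha_k] and [xi_k] decrease like [c ^ (2 k)] while [lam_k] decreases like
    [c ^ k].  Comparing the augmented Lagrangian at the iterate with its value
    at a consensus minimizer, where the residual [A x] vanishes and only the
    term [lam_k ^ 2 |theta_k| ^ 2 / 2] is left, and dividing by [lam_k], bounds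
    the objective from above by [F* + O(c ^ k)] ([dfal_objective_le]; under the
    stationarity criterion the gap comes from [small_subgradient_gap]).  The
    multiplier update says that [A x_k = lam_k (theta_k - theta_(k+1))], so
    that boundedness of the multipliers makes the residual, hence the
    disagreement along every edge, [O(c ^ k)] ([dfal_residual_le],
    [edge_le_constraint]).  Since a convex function bounded below is Lipschitz
    at the points of a ball, a nearly feasible point cannot have an objective
    much smaller than [F*] ([sum_obj_lower_bound]).  Thus iterate [k + 1] is
    [M c ^ k]-optimal and [M c ^ k]-feasible, with [M] independent of the graph
    ([dfal_rate]).

    The least [K] with [M c ^ K <= eps] is logarithmic in [1 / eps], and
    [c ^ (- K)] is [O(1 / eps)].  MS-APG is stopped after at most [max_inner k]
    iterations, which is [O(sqrt psi c ^ (- k))]; summing the geometric series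
    gives a total cost of [O(sqrt psi / eps)].  Finally
    [sqrt psi <= N psi ^ (3 / 2) / d_min] because [d_min <= N] and [1 <= psi];
    the latter is read off the trace of the Laplacian ([max_eigenvalue_ge1]). *)

Set Implicit Arguments.
Unset Strict Implicit.
Unset Printing Implicit Defensive.

Local Open Scope classical_set_scope.
Local Open Scope ring_scope.

(** * The Euclidean norm *)

Lemma norm2_sqr (R : realType) (m n : nat) (x : 'M[R]_(m, n)) :
  norm2 x ^+ 2 = \sum_i \sum_j x i j ^+ 2.
Proof.
rewrite sqr_sqrtr//; apply: sumr_ge0 => i _; apply: sumr_ge0 => j _.
exact: sqr_ge0.
Qed.

Lemma mxtrace_trmulE (R : realType) (m n : nat) (x y : 'M[R]_(m, n)) :
  \tr (x^T *m y) = \sum_i \sum_j x i j * y i j.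
Proof.
rewrite exchange_big; apply: eq_bigr => j _; rewrite !mxE.
by apply: eq_bigr => i _; rewrite !mxE.
Qed.

Lemma mxtrace_trmulC (R : realType) (m n : nat) (x y : 'M[R]_(m, n)) :
  \tr (x^T *m y) = \tr (y^T *m x).
Proof. by rewrite -mxtrace_tr trmx_mul trmxK. Qed.

Lemma norm2_sqr_tr (R : realType) (m n : nat) (x : 'M[R]_(m, n)) :
  norm2 x ^+ 2 = \tr (x^T *m x).
Proof.
rewrite norm2_sqr mxtrace_trmulE.
by under eq_bigr => i _ do under eq_bigr => j _ do rewrite expr2.
Qed.

Lemma norm2_ge0 (R : realType) (m n : nat) (x : 'M[R]_(m, n)) : 0 <= norm2 x.
Proof. exact: sqrtr_ge0. Qed.

Lemma norm2Z (R : realType) (m n : nat) (a : R) (x : 'M[R]_(m, n)) :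
  norm2 (a *: x) = `|a| * norm2 x.
Proof.
apply/eqP; rewrite -(@eqrXn2 _ 2)// ?mulr_ge0 ?norm2_ge0//.
rewrite exprMn real_normK ?num_real// !norm2_sqr mulr_sumr; apply/eqP.
apply: eq_bigr => i _; rewrite mulr_sumr; apply: eq_bigr => j _.
by rewrite !mxE exprMn.
Qed.

Lemma norm2N (R : realType) (m n : nat) (x : 'M[R]_(m, n)) :
  norm2 (- x) = norm2 x.
Proof. by rewrite -scaleN1r norm2Z normrN normr1 mul1r. Qed.

Lemma entry_le_norm2 (R : realType) (m n : nat) (x : 'M[R]_(m, n)) i j :
  `|x i j| <= norm2 x.
Proof.
rewrite -(@ler_pXn2r _ 2) ?nnegrE ?norm2_ge0// real_normK ?num_real// norm2_sqr.
rewrite (bigD1 i)//= (bigD1 j)//= -addrA lerDl addr_ge0//.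
  by apply: sumr_ge0 => k _; exact: sqr_ge0.
by do 2![apply: sumr_ge0 => ? _]; exact: sqr_ge0.
Qed.

Lemma norm2_0 (R : realType) (m n : nat) : norm2 (0 : 'M[R]_(m, n)) = 0.
Proof. by rewrite -(scale0r 0) norm2Z normr0 mul0r. Qed.

Lemma norm2_eq0 (R : realType) (m n : nat) (x : 'M[R]_(m, n)) :
  norm2 x = 0 -> x = 0.
Proof.
move=> x0; apply/matrixP => i j; rewrite mxE; apply/eqP; rewrite -normr_le0.
by rewrite -x0 entry_le_norm2.
Qed.

(** The squared norm of [norm2 y *: x - norm2 x *: y] is nonnegative. *)
Lemma cauchy_schwarz (R : realType) (m n : nat) (x y : 'M[R]_(m, n)) :
  \tr (x^T *m y) <= norm2 x * norm2 y.
Proof.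
have [/norm2_eq0->|x0] := eqVneq (norm2 x) 0.
  by rewrite linear0 mul0mx linear0 norm2_0 mul0r.
have [/norm2_eq0->|y0] := eqVneq (norm2 y) 0.
  by rewrite mulmx0 linear0 norm2_0 mulr0.
have xy : 0 < norm2 x * norm2 y by rewrite mulr_gt0// lt0r norm2_ge0 ?x0 ?y0.
have := sqr_ge0 (norm2 (norm2 y *: x - norm2 x *: y)).
have -> : norm2 (norm2 y *: x - norm2 x *: y) ^+ 2 =
    2 * (norm2 x * norm2 y) * (norm2 x * norm2 y - \tr (x^T *m y)).
  rewrite -scaleNr norm2_sqr_tr [(_ + _)^T]linearD/= ![(_ *: _)^T]linearZ/=.
  rewrite mulmxDl !mulmxDr -!scalemxAl -!scalemxAr !scalerA.
  by rewrite !(mxtraceD, mxtraceZ) (mxtrace_trmulC y) -!norm2_sqr_tr; ring.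
by rewrite pmulr_rge0 ?subr_ge0// mulr_gt0.
Qed.

Lemma norm2D (R : realType) (m n : nat) (x y : 'M[R]_(m, n)) :
  norm2 (x + y) <= norm2 x + norm2 y.
Proof.
rewrite -(@ler_pXn2r _ 2) ?nnegrE ?addr_ge0 ?norm2_ge0//.
have -> : norm2 (x + y) ^+ 2 =
    norm2 x ^+ 2 + 2 * \tr (x^T *m y) + norm2 y ^+ 2.
  rewrite !norm2_sqr_tr [(_ + _)^T]linearD/= mulmxDl !mulmxDr.
  rewrite !linearD/= (mxtrace_trmulC y).
  by ring.
have := cauchy_schwarz x y; nra.
Qed.

Lemma norm2B (R : realType) (m n : nat) (x y : 'M[R]_(m, n)) :
  norm2 (x - y) <= norm2 x + norm2 y.
Proof. by rewrite -(norm2N y) norm2D. Qed.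

Lemma norm2_distC (R : realType) (m n : nat) (x y : 'M[R]_(m, n)) :
  norm2 (x - y) = norm2 (y - x).
Proof. by rewrite -norm2N opprB. Qed.

Lemma dot_le_norm2 (R : realType) (n : nat) (u v : 'rV[R]_n) :
  dot u v <= norm2 u * norm2 v.
Proof.
by apply: le_trans (cauchy_schwarz u v); rewrite mxtrace_trmulE big_ord1.
Qed.

Lemma norm2_row_le (R : realType) (m n : nat) (x : 'M[R]_(m, n)) i :
  norm2 (row i x) <= norm2 x.
Proof.
rewrite -(@ler_pXn2r _ 2) ?nnegrE ?norm2_ge0// !norm2_sqr big_ord1.
rewrite (bigD1 i)//=; under eq_bigr => j _ do rewrite mxE.
by rewrite lerDl; do 2![apply: sumr_ge0 => ? _]; exact: sqr_ge0.
Qed.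

Lemma norm2_isometry (R : realType) (p q r : nat) (U : 'M[R]_(p, q))
    (y : 'M[R]_(q, r)) : U^T *m U = 1%:M -> norm2 (U *m y) = norm2 y.
Proof.
move=> UU; apply/eqP; rewrite -(@eqrXn2 _ 2)// ?norm2_ge0// !norm2_sqr_tr.
by rewrite trmx_mul -mulmxA (mulmxA U^T) UU mul1mx.
Qed.

(** * Convex functions *)

(** Convexity with weights in [R] rather than in the library's type of elements
    of [[0, 1]], so that weights can be computed with field arithmetic. *)
Definition jensen (R : realType) (V : lmodType R) (f : V -> R) : Prop :=
  forall t x y, 0 <= t <= 1 ->
    f (t *: x + (1 - t) *: y) <= t * f x + (1 - t) * f y.

Lemma convex_function_jensen (R : realType) (V : lmodType R) (f : V -> R) :
  convex_function setT f -> jensen f.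
Proof.
move=> cf t x y /andP[t0 t1].
exact: (cf (Itv01 t0 t1) x y (in_setT _) (in_setT _)).
Qed.

Lemma jensenD (R : realType) (V : lmodType R) (f g : V -> R) :
  jensen f -> jensen g -> jensen (fun x => f x + g x).
Proof.
move=> cf cg t x y t01; apply: le_trans (lerD (cf t x y t01) (cg t x y t01)) _.
by lra.
Qed.

Lemma jensen_sum (R : realType) (V : lmodType R) (N : nat)
    (f : 'I_N -> V -> R) :
  (forall i, jensen (f i)) -> jensen (fun x => \sum_i f i x).
Proof.
move=> cf t x y t01; rewrite !mulr_sumr -big_split/=.
by apply: ler_sum => i _; exact: cf.
Qed.

Lemma jensenM (R : realType) (V : lmodType R) (a : R) (f : V -> R) :
  0 <= a -> jensen f -> jensen (fun x => a * f x).
Proof.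
move=> a0 cf t x y t01; rewrite mulrCA (mulrCA (1 - t)) -mulrDr.
by rewrite ler_wpM2l// cf.
Qed.

Lemma jensen_comp (R : realType) (V W : lmodType R) (g : {linear V -> W})
    (f : W -> R) : jensen f -> jensen (f \o g).
Proof. by move=> cf t x y t01 /=; rewrite linearD !linearZ; exact: cf. Qed.

Lemma jensen_sqr_affine (R : realType) (V : lmodType R) (m n : nat)
    (g : {linear V -> 'M[R]_(m, n)}) (b : 'M[R]_(m, n)) :
  jensen (fun x => norm2 (g x - b) ^+ 2).
Proof.
move=> t x y /andP[t0 t1].
have -> : g (t *: x + (1 - t) *: y) - b =
    t *: (g x - b) + (1 - t) *: (g y - b).
  rewrite linearD !linearZ/= !scalerBr addrACA -opprD -scalerDl subrKC.
  by rewrite scale1r.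
set u := g x - b; set v := g y - b.
have le_uv : norm2 (t *: u + (1 - t) *: v) <= t * norm2 u + (1 - t) * norm2 v.
  by rewrite (le_trans (norm2D _ _))// !norm2Z !ger0_norm ?subr_ge0.
have := norm2_ge0 u; have := norm2_ge0 v.
have := norm2_ge0 (t *: u + (1 - t) *: v); move: le_uv.
move: (norm2 _) (norm2 u) (norm2 v) => s p q spq s0 q0 p0.
apply: (@le_trans _ _ ((t * p + (1 - t) * q) ^+ 2)); first by nra.
rewrite -subr_ge0; have -> : t * p ^+ 2 + (1 - t) * q ^+ 2 -
  (t * p + (1 - t) * q) ^+ 2 = t * (1 - t) * (p - q) ^+ 2 by ring.
by apply: mulr_ge0; [rewrite mulr_ge0 ?subr_ge0|exact: sqr_ge0].
Qed.

Lemma jensen_mean (R : realType) (V : lmodType R) (f : V -> R) (m : nat)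
    (v : 'I_m.+1 -> V) : jensen f ->
  f (m.+1%:R^-1 *: \sum_i v i) <= m.+1%:R^-1 * \sum_i f (v i).
Proof.
move=> cf; elim: m v => [|m IH] v.
  by rewrite !big_ord1 invr1 scale1r mul1r.
rewrite !(big_ord_recr m.+1)/=.
set S := \sum_(i < m.+1) _; set T := \sum_(i < m.+1) f _.
have m0 : (m.+1%:R : R) != 0 by rewrite pnatr_eq0.
have m1 : (m.+2%:R : R) != 0 by rewrite pnatr_eq0.
have m1' : (1 + m.+1%:R : R) != 0 by rewrite -(natrD _ 1).
(* the mean of m + 2 points is the combination, with this weight, of the mean
   of the first m + 1 points and of the last point *)
pose t : R := m.+1%:R / m.+2%:R.
have t01 : 0 <= t <= 1.
  by rewrite divr_ge0//= ler_pdivrMr ?ltr0n// mul1r ler_nat.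
have e1 : 1 - t = m.+2%:R^-1.
  by rewrite /t -[m.+2%:R]/((1 + m.+1)%:R) natrD; field.
have e2 : t * m.+1%:R^-1 = m.+2%:R^-1 by rewrite /t mulrAC mulfV// mul1r.
have -> : m.+2%:R^-1 *: (S + v ord_max) =
    t *: (m.+1%:R^-1 *: S) + (1 - t) *: v ord_max.
  by rewrite e1 scalerDr scalerA e2.
apply: (le_trans (cf _ _ _ t01)); rewrite e1 mulrDr lerD2r.
have /andP[t0 _] := t01.
by rewrite (le_trans (ler_wpM2l t0 (IH _)))// mulrA e2.
Qed.

Lemma jensen_segment_le (R : realType) (V : lmodType R) (f : V -> R) (v : V)
    (s r : R) : jensen f -> (forall x, 0 <= f x) -> 0 < r -> `|s| <= r ->
  f (s *: v) <= f (r *: v) + f (- r *: v).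
Proof.
move=> cf f0 r0; rewrite ler_norml => /andP[rs sr].
pose t := (s + r) / (2 * r).
have r2 : 0 < 2 * r by rewrite mulr_gt0.
have t01 : 0 <= t <= 1.
  rewrite divr_ge0 ?(ltW r2)//=; last by lra.
  by rewrite ler_pdivrMr// mul1r; lra.
have -> : s *: v = t *: (r *: v) + (1 - t) *: (- r *: v).
  rewrite !scalerA -scalerDl; congr (_ *: _); rewrite /t; field.
  by rewrite gt_eqF.
apply: (le_trans (cf _ _ _ t01)); have /andP[t0 t1] := t01.
have := f0 (r *: v); have := f0 (- r *: v); nra.
Qed.

(** A point of the ball of radius [r] is the mean of the points
    [n x_j e_j], each of which lies between [- n r e_j] and [n r e_j]. *)
Lemma jensen_bounded_on_ball (R : realType) (n : nat) (f : 'rV[R]_n -> R)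
    (r : R) : jensen f -> (forall x, 0 <= f x) ->
  exists2 M : R, 0 <= M & forall x, norm2 x <= r -> f x <= M.
Proof.
case: n f => [|n] f cf f0.
  by exists (f 0) => // x _; rewrite [x]thinmx0.
pose s := n.+1%:R * (`|r| + 1).
have s0 : 0 < s by rewrite mulr_gt0 ?ltr0n// ltr_wpDl.
exists (n.+1%:R^-1 * \sum_j (f (s *: delta_mx 0 j) + f (- s *: delta_mx 0 j))).
  by rewrite mulr_ge0// sumr_ge0// => j _; rewrite addr_ge0.
move=> x xr.
have -> : x = n.+1%:R^-1 *: \sum_j (n.+1%:R * x 0 j) *: delta_mx 0 j.
  rewrite {1}[x]row_sum_delta scaler_sumr; apply: eq_bigr => j _.
  by rewrite scalerA mulrA mulVf ?mul1r// pnatr_eq0.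
rewrite (le_trans (jensen_mean _ cf))// ler_wpM2l//.
apply: ler_sum => j _; apply: jensen_segment_le => //.
rewrite normrM normr_nat ler_pM2l ?ltr0n// (le_trans (entry_le_norm2 _ _ _))//.
by rewrite (le_trans xr)// (le_trans (ler_norm r))// lerDl.
Qed.

(** [y] is a convex combination of [x] and of the point [z] at distance 1
    beyond [y] on the line through [x] and [y]; since [f x >= 0], only an upper
    bound for [f z] matters. *)
Lemma jensen_lipschitz_on_ball (R : realType) (n : nat) (f : 'rV[R]_n -> R)
    (r : R) : jensen f -> (forall x, 0 <= f x) ->
  exists2 M : R, 0 <= M & forall x y, norm2 y <= r ->
    f y - f x <= M * norm2 (y - x).
Proof.
move=> cf f0; have [M M0 fM] := jensen_bounded_on_ball (r + 1) cf f0.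
exists M => // x y yr; set d := norm2 (y - x).
have [/norm2_eq0/eqP|dn0] := eqVneq d 0.
  by rewrite subr_eq0 => /eqP ->; rewrite subrr mulr_ge0// norm2_ge0.
have d0 : 0 < d by rewrite lt0r dn0 norm2_ge0.
pose z := y + d^-1 *: (y - x); pose t := d / (1 + d).
have fz : f z <= M.
  apply: fM; rewrite (le_trans (norm2D _ _))// lerD// norm2Z.
  by rewrite gtr0_norm ?invr_gt0// mulVf.
have d1 : 1 + d != 0 by rewrite gt_eqF// addr_gt0.
have t01 : 0 <= t <= 1.
  rewrite divr_ge0 ?(ltW d0) ?addr_ge0 ?(ltW d0)//= ler_pdivrMr ?addr_gt0//.
  by rewrite mul1r lerDr.
have yE : y = t *: z + (1 - t) *: x.
  have e1 : t * d^-1 = 1 - t by rewrite /t; field; rewrite dn0 d1.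
  rewrite /z scalerDr scalerA e1 scalerBr addrA subrK -scalerDl.
  by rewrite subrKC scale1r.
have := cf t z x t01; rewrite -yE => fy.
have /andP[t0 t1] := t01.
have td : t <= d.
  by rewrite /t ler_pdivrMr ?addr_gt0// ler_peMr ?(ltW d0)// lerDl (ltW d0).
have h1 : f y - f x <= t * f z.
  have := f0 x; nra.
by rewrite (le_trans h1)// mulrC ler_pM.
Qed.

(** On [0 < h <= 1] the difference quotients in direction [v] are at most
    [f (x + v) - f x]; let [h] tend to 0 from the right. *)
Lemma jensen_derive_le (R : realType) (V : normedModType R) (f : V -> R^o)
    (x v : V) : jensen f -> derivable f x v -> f x + 'D_v f x <= f (x + v).
Proof.
move=> cf df; rewrite -lerBrDl; apply: cvgr_to_le (cvg_dnbhs_at_right df) _.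
near=> h.
have h0 : 0 < h by near: h; exact: nbhs_right_gt.
have h1 : h <= 1 by near: h; exact: nbhs_right_le.
rewrite /= -[_ *: _]/(h^-1 * _) ler_pdivrMl//.
have h01 : 0 <= h <= 1 by rewrite (ltW h0).
have := cf h (x + v) x h01.
have -> : h *: (x + v) + (1 - h) *: x = h *: v + x.
  by rewrite scalerDr addrAC -scalerDl subrKC scale1r addrC.
by move=> fh; lra.
Unshelve. all: by end_near.
Qed.

(** * Convexity and smoothness of the augmented Lagrangian *)

Lemma stack_is_linear (R : realType) (N n : nat) : linear (@stack R N n).
Proof. by move=> a x y; apply/matrixP => k l; rewrite !mxE. Qed.

HB.instance Definition _ (R : realType) (N n : nat) :=
  GRing.isLinear.Build R 'M[R]_(N, n) 'cV[R]_(N * n) _ (@stack R N n)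
    (@stack_is_linear R N n).

Lemma linear_mx_differentiable (R : realType) (m n : nat)
    (W : normedModType R) (g : {linear 'M[R]_(m, n) -> W}) x :
  differentiable g x.
Proof.
have -> : (g : _ -> _) =
    \sum_i \sum_j (fun x : 'M[R]_(m, n) => x i j *: g (delta_mx i j)).
  apply/funext => z; rewrite {1}[z]matrix_sum_delta linear_sum fct_sumE.
  apply: eq_bigr => i _; rewrite linear_sum fct_sumE.
  by apply: eq_bigr => j _; rewrite linearZ.
apply: differentiable_sum => i; apply: differentiable_sum => j.
exact/differentiableZl/differentiable_coord.
Qed.

Lemma sqr_affine_differentiable (R : realType) (m n p q : nat)
    (g : {linear 'M[R]_(m, n) -> 'M[R]_(p, q)}) (b : 'M[R]_(p, q)) x :
  differentiable (fun z => norm2 (g z - b) ^+ 2 : R^o) x.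
Proof.
have -> : (fun z => norm2 (g z - b) ^+ 2 : R^o) =
    \sum_i \sum_j (((fun y : 'M[R]_(p, q) => y i j : R^o) \o g) -
      cst (b i j)) ^+ 2.
  apply/funext => z; rewrite norm2_sqr fct_sumE; apply: eq_bigr => i _.
  by rewrite fct_sumE; apply: eq_bigr => j _; rewrite !mxE.
apply: differentiable_sum => i; apply: differentiable_sum => j.
apply/differentiableX/differentiableB => //.
apply: differentiable_comp; first exact: linear_mx_differentiable.
exact: differentiable_coord.
Qed.

(** The derivative is linear in the direction [z - x], which decomposes along
    the standard basis into the directions defining [grad_block]. *)
Lemma gradient_inequality (R : realType) (m n : nat) (f : 'M[R]_(m, n) -> R)
    (x z : 'M[R]_(m, n)) :
  jensen f -> differentiable (f : 'M[R]_(m, n) -> R^o) x ->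
  f x + \sum_i dot (grad_block f i x) (row i z - row i x) <= f z.
Proof.
move=> cf df.
have := jensen_derive_le cf (@diff_derivable _ _ _ _ _ (z - x) df).
rewrite subrKC deriveE// {1}[z - x]matrix_sum_delta linear_sum.
suff -> : \sum_i 'd (f : 'M[R]_(m, n) -> R^o) x
      (\sum_j (z - x) i j *: delta_mx i j) =
    \sum_i dot (grad_block f i x) (row i z - row i x) by [].
apply: eq_bigr => i _; rewrite linear_sum; apply: eq_bigr => j _.
by rewrite linearZ !mxE deriveE// mulrC.
Qed.

Lemma smooth_part_jensen (R : realType) (N n m : nat) (A : 'M[R]_(m, N * n))
    (gamma : 'I_N -> 'rV[R]_n -> R) lam th :
  (forall i, jensen (gamma i)) -> 0 <= lam ->
  jensen (smooth_part A gamma lam th).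
Proof.
move=> cg lam0; apply: jensenD.
  by apply: jensenM => //; apply: jensen_sum => i; exact: jensen_comp (cg i).
apply: jensenM; first by rewrite invr_ge0.
exact: (jensen_sqr_affine (mulmx A \o @stack R N n)).
Qed.

Lemma smooth_part_differentiable (R : realType) (N n m : nat)
    (A : 'M[R]_(m, N * n)) (gamma : 'I_N -> 'rV[R]_n -> R) lam th x :
  (forall i x, differentiable (gamma i : 'rV[R]_n -> R^o) x) ->
  differentiable (smooth_part A gamma lam th : 'M[R]_(N, n) -> R^o) x.
Proof.
move=> dg.
have -> : (smooth_part A gamma lam th : 'M[R]_(N, n) -> R^o) =
    lam *: (\sum_i ((gamma i : 'rV[R]_n -> R^o) \o row i)) +
    2^-1 *: (fun z => norm2 ((mulmx A \o @stack R N n) z - lam *: th) ^+ 2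
      : R^o).
  by apply/funext => z; rewrite /smooth_part/= !fctE fct_sumE.
apply: differentiableD; apply: differentiableZ.
  apply: differentiable_sum => i; apply: differentiable_comp => //.
  exact: linear_mx_differentiable.
exact: sqr_affine_differentiable.
Qed.

(** * Near-minimality of an approximately stationary point *)

(** The subgradient inequality for the [rho i] and the gradient inequality for
    the smooth part bound the gap by the sum of the [dot (g i) (x_i - z_i)],
    and each [g i] has norm at most [xi]. *)
Lemma small_subgradient_gap (R : realType) (N n m : nat)
    (A : 'M[R]_(m, N * n)) (rho gamma : 'I_N -> 'rV[R]_n -> R)
    (lam xi r : R) th (x z : 'M[R]_(N, n)) :
  (forall i, jensen (gamma i)) ->
  (forall i x, differentiable (gamma i : 'rV[R]_n -> R^o) x) ->
  0 <= lam -> 0 <= xi -> norm2 x <= r -> norm2 z <= r ->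
  small_subgradient A rho gamma lam th xi x ->
  aug_lagrangian A rho gamma lam th x - aug_lagrangian A rho gamma lam th z
    <= N%:R * (2 * r) * xi.
Proof.
move=> cg dg lam0 xi0 xr zr [g gP].
have := gradient_inequality z (@smooth_part_jensen _ _ _ _ A _ lam th cg lam0)
  (smooth_part_differentiable A lam th x dg).
rewrite /aug_lagrangian; set f := smooth_part _ _ _ _ => fz.
have rho_le i : lam * rho i (row i x) - lam * rho i (row i z) -
    dot (grad_block f i x) (row i z - row i x) <= 2 * r * xi.
  have [[q qP gE] gi] := gP i.
  have N1 : 1 <= Num.sqrt (N%:R : R).
    by rewrite -[leLHS]sqrtr1 ler_wsqrtr// ler1n (leq_ltn_trans _ (ltn_ord i)).
  have gxi : norm2 (g i) <= xi.
    by rewrite (le_trans gi)// ler_pdivrMr ?(lt_le_trans _ N1)// ler_peMr.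
  have xz : norm2 (row i x - row i z) <= 2 * r.
    rewrite (le_trans (norm2B _ _))// mulr_natl mulr2n lerD//.
      by rewrite (le_trans (norm2_row_le _ _)).
    by rewrite (le_trans (norm2_row_le _ _)).
  have := dot_le_norm2 (g i) (row i x - row i z).
  have -> : dot (g i) (row i x - row i z) =
      - lam * dot q (row i z - row i x) -
      dot (grad_block f i x) (row i z - row i x).
    rewrite gE /dot mulr_sumr -sumrB; apply: eq_bigr => j _.
    by rewrite !mxE; ring.
  have : norm2 (g i) * norm2 (row i x - row i z) <= 2 * r * xi.
    by rewrite mulrC ler_pM ?norm2_ge0.
  move: qP; rewrite inE => /(_ (row i z)) /(ler_wpM2l lam0).
  rewrite mulrDr mulNr; move: (dot (grad_block f i x) _) (lam * dot _ _).
  move: (lam * rho i _) (lam * rho i _) (norm2 _ * norm2 _) (2 * r * xi).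
  by move=> *; lra.
have : \sum_i (lam * rho i (row i x) - lam * rho i (row i z) -
    dot (grad_block f i x) (row i z - row i x)) <= \sum_(i < N) 2 * r * xi.
  by apply: ler_sum => i _; exact: rho_le.
rewrite !sumrB -!mulr_sumr sumr_const card_ord -[_ *+ N]mulr_natl !mulrA.
by move: fz; lra.
Qed.

(** * The graph and the constraint matrix *)

Lemma sum_mxtens (R : realType) (m n : nat) (F : 'I_m -> 'I_n -> R) :
  \sum_k F (mxtens_unindex k).1 (mxtens_unindex k).2 = \sum_i \sum_j F i j.
Proof.
rewrite pair_big (reindex (@mxtens_unindex m n))//=.
by exists (@mxtens_index m n) => ? _; rewrite ?mxtens_indexK ?mxtens_unindexK.
Qed.

(** This turns the action of the edge matrix on stacked points into that of the
    incidence matrix on matrices of rows. *)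
Lemma tensmx1_stack (R : realType) (m N n : nat) (M : 'M[R]_(m, N))
    (x : 'M[R]_(N, n)) : (M *t 1%:M) *m stack x = stack (M *m x).
Proof.
apply/matrixP => k l; rewrite !mxE.
under eq_bigr => h _ do rewrite !mxE.
rewrite (sum_mxtens (fun i j => M (mxtens_unindex k).1 i *
  (((mxtens_unindex k).2 == j)%:R : R) * x i j)).
apply: eq_bigr => i _; rewrite (bigD1 (mxtens_unindex k).2)//= eqxx mulr1.
by rewrite big1 ?addr0// => j /negPf jk; rewrite eq_sym jk mulr0 mul0r.
Qed.

Lemma norm2_stack (R : realType) (N n : nat) (x : 'M[R]_(N, n)) :
  norm2 (stack x) = norm2 x.
Proof.
congr Num.sqrt; under eq_bigr => k _ do rewrite big_ord1 mxE.
by rewrite (sum_mxtens (fun i j => x i j ^+ 2)).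
Qed.

(** The edge matrix is [U *m A], and [U] has orthonormal columns. *)
Lemma norm2_constraint (R : realType) (N n : nat) (e : rel 'I_N)
    (A : 'M[R]_(N.-1 * n, N * n)) (x : 'M[R]_(N, n)) :
  is_constraint_matrix e A ->
  norm2 (A *m stack x) = norm2 (incidence R e *m x).
Proof.
move=> [U [s [V [UU _ _ CE ->]]]].
rewrite -(norm2_stack (_ *m x)) -tensmx1_stack -/(edge_matrix R e n) CE.
rewrite -!mulmxA.
by rewrite (norm2_isometry _ UU).
Qed.

(** The difference of the two ends of an edge is, up to sign, a row of
    [incidence R e *m x]. *)
Lemma edge_le_constraint (R : realType) (N n : nat) (e : rel 'I_N)
    (A : 'M[R]_(N.-1 * n, N * n)) (x : 'M[R]_(N, n)) i j :
  connected_graph e -> is_constraint_matrix e A -> e i j ->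
  norm2 (row i x - row j x) <= norm2 (A *m stack x).
Proof.
move=> [esym eirr _] hA; rewrite (norm2_constraint x hA).
wlog lt_ij : i j / (i < j)%N.
  move=> H eij; have [|ji|/val_inj ij] := ltngtP i j; first by move/H; exact.
    by rewrite norm2_distC H// esym.
  by rewrite ij eirr in eij.
move=> eij; have ije : (i, j) \in edges e by rewrite inE lt_ij.
apply: le_trans (norm2_row_le _ (enum_rank_in ije (i, j))).
rewrite le_eqVlt; apply/orP; left; apply/eqP; congr norm2.
apply/matrixP => a l; rewrite !mxE.
under eq_bigr => h _ do rewrite !mxE enum_rankK_in//= mulrBl.
rewrite sumrB; congr (_ - _).
  rewrite (bigD1 i)//= eqxx mul1r big1 ?addr0// => h /negPf ->.
  by rewrite mul0r.
rewrite (bigD1 j)//= eqxx mul1r big1 ?addr0// => h /negPf ->.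
by rewrite mul0r.
Qed.

(** A shortest path between two nodes has fewer than [N] edges. *)
Lemma consensus_gap_le (R : realType) (N n : nat) (e : rel 'I_N)
    (x : 'M[R]_(N, n)) (d : R) i j :
  connected_graph e -> eps_feasible e d x -> 0 <= d ->
  norm2 (row i x - row j x) <= N%:R * d.
Proof.
move=> [_ _ /(_ i j) /connectP[p0 + ->]] xd d0.
case/shortenP=> p ep up _.
have : norm2 (row i x - row (last i p) x) <= (size p)%:R * d.
  elim: p i {up} ep => [|k p IH] i /=; first by rewrite subrr norm2_0 mul0r.
  case/andP=> eik /IH kp; rewrite -(subrKA (row k x)) (le_trans (norm2D _ _))//.
  by rewrite -natr1 mulrDl mul1r addrC lerD// xd.
move/le_trans; apply; rewrite ler_wpM2r// ler_nat.
have := max_card (mem (i :: p)).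
by rewrite (card_uniqP up) card_ord => /ltnW.
Qed.

Lemma degree_bounds (N : nat) (e : rel 'I_N) i :
  (1 < N)%N -> connected_graph e -> (0 < degree e i <= N)%N.
Proof.
move=> N1 [_ eirr econn]; apply/andP; split; last first.
  by rewrite -[leqRHS]card_ord max_card.
have [j ij] : exists j : 'I_N, i != j.
  have [i0|i0] := eqVneq (i : nat) 0%N.
    by exists (Ordinal N1); rewrite -val_eqE/= i0.
  by exists (Ordinal (ltnW N1)); rewrite -val_eqE.
have /connectP[[|k p] /= ep jE] := econn i j; first by rewrite jE eqxx in ij.
by apply/card_gt0P; exists k; case/andP: ep.
Qed.

Lemma min_degree_bounds (N : nat) (e : rel 'I_N) :
  (1 < N)%N -> connected_graph e -> (0 < min_degree e <= N)%N.
Proof.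
move=> N1 ce; rewrite /min_degree.
apply: (big_ind (fun d => 0 < d <= N)%N).
- by rewrite leqnn ltnW.
- move=> a b /andP[a0 aN] /andP[b0 bN].
  by rewrite leq_min a0 b0 geq_min aN.
- by move=> i _; exact: degree_bounds.
Qed.

Lemma sum_indicator (R : realType) (N : nat) (a : 'I_N) (G : 'I_N -> R) :
  \sum_i (a == i)%:R * G i = G a.
Proof.
rewrite (bigD1 a)//= eqxx mul1r big1 ?addr0// => i /negPf ia.
by rewrite eq_sym ia mul0r.
Qed.

Lemma incidence_laplacian (R : realType) (N : nat) (e : rel 'I_N) :
  connected_graph e ->
  (incidence R e)^T *m incidence R e = laplacian R e.
Proof.
move=> [esym eirr _]; apply/matrixP => a b; rewrite !mxE.
under eq_bigr => k _ do rewrite !mxE.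
rewrite -(big_enum_val (fun p : 'I_N * 'I_N =>
  ((a == p.1)%:R - (a == p.2)%:R) * ((b == p.1)%:R - (b == p.2)%:R) : R)).
(* w i j says that the edge between i and j is oriented from i to j *)
pose w (i j : 'I_N) : R := ((i < j)%N && e i j)%:R.
transitivity (\sum_i \sum_j w i j *
    (((a == i)%:R - (a == j)%:R) * ((b == i)%:R - (b == j)%:R))).
  rewrite pair_bigA/= big_mkcond; apply: eq_bigr => p _; rewrite inE /w.
  by case: (_ && _); rewrite ?mul1r ?mul0r.
have wE i j : w i j + w j i = (e i j)%:R.
  rewrite /w (esym j i).
  by have [ij|ij|/val_inj ->] := ltngtP i j; rewrite ?eirr ?andbF ?add0r ?addr0.
transitivity ((a == b)%:R * (\sum_j (w a j + w j a)) - (w a b + w b a)).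
  rewrite big_split/= mulrDr.
  transitivity (\sum_i (a == i)%:R * ((b == i)%:R * (\sum_j w i j)) +
     \sum_j (a == j)%:R * ((b == j)%:R * (\sum_i w i j)) -
    (\sum_i (a == i)%:R * (\sum_j (b == j)%:R * w i j) +
     \sum_i (b == i)%:R * (\sum_j (a == j)%:R * w i j))).
    have -> : \sum_j (a == j)%:R * ((b == j)%:R * (\sum_i w i j)) =
        \sum_i \sum_j (a == j)%:R * ((b == j)%:R * w i j).
      rewrite exchange_big; apply: eq_bigr => j _.
      by rewrite -!mulr_sumr.
    rewrite -!big_split -sumrB; apply: eq_bigr => i _.
    rewrite !mulr_sumr -!big_split -sumrB/=; apply: eq_bigr => j _.
    by ring.
  rewrite !sum_indicator; rewrite (eq_sym b a); ring.
rewrite wE (eq_bigr _ (fun j _ => wE a j)).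
have [->|ab] := eqVneq a b.
  rewrite eirr subr0 mul1r /degree -natr_sum; congr _%:R.
   rewrite -sum1_card [RHS]big_mkcond; apply: eq_bigr => j _.
  by rewrite inE; case: (e b j).
by rewrite mul0r sub0r; case: (e a b); rewrite ?oppr0.
Qed.

(** The columns of [V] are eigenvectors of [laplacian *t 1], hence, reshaped
    as matrices, they consist of eigenvectors of the Laplacian. *)
Lemma sqr_singular_value_le (R : realType) (N n : nat) (e : rel 'I_N)
    (psi : R) (s : 'rV[R]_(N.-1 * n)) (V : 'M[R]_(N * n, N.-1 * n)) k :
  connected_graph e -> is_max_eigenvalue (laplacian R e) psi ->
  V^T *m V = 1%:M ->
  laplacian R e *t 1%:M = V *m (diag_mx s *m diag_mx s) *m V^T ->
  s 0 k ^+ 2 <= psi.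
Proof.
move=> ce [_ psi_max] VV LE; apply: psi_max.
pose W : 'M[R]_(N, n) := \matrix_(i, j) V (mxtens_index (i, j)) k.
have WE : stack W = col k V.
  by apply/matrixP => h l; rewrite !mxE -surjective_pairing mxtens_unindexK.
have LW : laplacian R e *m W = s 0 k ^+ 2 *: W.
  have : stack (laplacian R e *m W) = stack (s 0 k ^+ 2 *: W).
    rewrite -tensmx1_stack LE linearZ/= WE !colE -!mulmxA.
    rewrite (mulmxA V^T) VV mul1mx (mulmxA (diag_mx s)) mulmx_diag scalemxAr.
    congr (V *m _); apply/matrixP => h l; rewrite !mxE.
    rewrite (bigD1 h)//= !mxE eqxx mulr1n big1 ?addr0; last first.
      by move=> h' /negPf hh'; rewrite !mxE eq_sym hh' mulr0n mul0r.
    have [->|hk] := eqVneq h k; first by rewrite expr2.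
    by rewrite !mulr0.
  move/matrixP => H; apply/matrixP => i j.
  by have := H (mxtens_index (i, j)) 0; rewrite ![stack _ _ _]mxE mxtens_indexK.
have [l Wl0] : exists l, col l W != 0.
  apply/existsP; apply: contraT => /existsPn W0.
  have : (V^T *m V) k k = 0.
    rewrite mxE big1// => h _; rewrite !mxE.
    have := W0 (mxtens_unindex h).2; rewrite negbK => /eqP/matrixP.
    move=> /(_ (mxtens_unindex h).1 0); rewrite !mxE -surjective_pairing.
    by rewrite mxtens_unindexK => ->; rewrite mulr0.
  by rewrite VV mxE eqxx => /eqP; rewrite oner_eq0.
apply/eigenvalueP; exists (col l W)^T; last first.
  by rewrite -(inj_eq (@trmx_inj _ _ _)) trmxK linear0.
have LT : (laplacian R e)^T = laplacian R e.
  by rewrite -(incidence_laplacian R ce) trmx_mul trmxK.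
by rewrite -LT -trmx_mul !colE mulmxA LW -scalemxAl linearZ.
Qed.

(** The trace of [laplacian *t 1] is [n] times the sum of the degrees, hence at
    least [n N]; it is also the sum of the [(N - 1) n] squared singular values,
    each of which is at most [psi]. *)
Lemma max_eigenvalue_ge1 (R : realType) (N n : nat) (e : rel 'I_N)
    (A : 'M[R]_(N.-1 * n, N * n)) (psi : R) :
  (1 < N)%N -> (0 < n)%N -> connected_graph e -> is_constraint_matrix e A ->
  is_max_eigenvalue (laplacian R e) psi -> 1 <= psi.
Proof.
move=> N1 n0 ce [U [s [V [UU VV _ CE _]]]] hpsi.
have LE : laplacian R e *t 1%:M = V *m (diag_mx s *m diag_mx s) *m V^T.
  rewrite -(incidence_laplacian R ce) -[1%:M]mulmx1 -{1}[1%:M]trmx1.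
  rewrite -tensmx_mul -trmx_tens -/(edge_matrix R e n) CE.
  by rewrite !trmx_mul trmxK tr_diag_mx !mulmxA -(mulmxA _ _ U) UU mulmx1.
have : \tr (laplacian R e *t 1%:M : 'M[R]_(N * n)) <= (N.-1 * n)%:R * psi.
  rewrite LE mxtrace_mulC (mulmxA V^T) VV mul1mx mulmx_diag mxtrace_diag.
  rewrite -[(N.-1 * n)%N in leRHS]card_ord mulr_natl -sumr_const.
  apply: ler_sum => k _; rewrite mxE -expr2.
  exact: sqr_singular_value_le hpsi VV LE.
have -> : \tr (laplacian R e *t 1%:M : 'M[R]_(N * n)) =
    (\sum_i (degree e i)%:R) * n%:R.
  have := @mulr_sum R N n (fun i => laplacian R e i i) (fun => 1).
  rewrite sumr_const card_ord => H; rewrite /mxtrace.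
  under eq_bigr => k _ do rewrite mxE [1%:M _ _]mxE eqxx.
  rewrite -H; congr (_ * _); apply: eq_bigr => i _.
  by rewrite mxE eqxx.
have deg : N%:R <= \sum_i (degree e i)%:R :> R.
  rewrite -[N in leLHS]card_ord -sumr_const; apply: ler_sum => i _.
  by rewrite ler1n; case/andP: (degree_bounds i N1 ce).
have n0' : 0 < n%:R :> R by rewrite ltr0n.
rewrite natrM mulrAC ler_pM2r// => dpsi.
have N0 : 0 < N%:R :> R by rewrite ltr0n ltnW.
have : N%:R * 1 <= N%:R * psi.
  rewrite mulr1 (le_trans deg)// (le_trans dpsi)//.
  have : 0 <= N.-1%:R * psi.
    by rewrite (le_trans _ dpsi)// (le_trans _ deg)// ltW.
  rewrite pmulr_rge0; last by rewrite ltr0n -ltnS prednK// ltnW.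
  by move=> psi0; rewrite ler_wpM2r// ler_nat leq_pred.
by rewrite ler_pM2l.
Qed.

(** * Estimates along the iterates *)

Lemma geometric_from1E (R : realType) (q a : R) k :
  geometric_from1 q a k.+1 = q ^+ k * a.
Proof.
rewrite /geometric_from1/=; elim: k => [|k IH] /=; first by rewrite mul1r.
by rewrite IH exprS mulrA.
Qed.

Lemma geometric_from1_gt0 (R : realType) (q a : R) k :
  0 < q -> 0 < a -> 0 < geometric_from1 q a k.
Proof.
move=> q0 a0; rewrite /geometric_from1.
by elim: k.-1 => [//|j IH] /=; rewrite mulr_gt0.
Qed.

(** The multiplier update expresses the residual through two consecutive
    multipliers. *)
Lemma dfal_residual_le (R : realType) (N n m : nat) (A : 'M[R]_(m, N * n))
    (rho gamma : 'I_N -> 'rV[R]_n -> R) (c lam1 alpha1 xi1 Bx Bth : R)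
    (x xs : nat -> 'M[R]_(N, n)) th k :
  0 < c -> 0 < lam1 -> dfal A rho gamma c lam1 alpha1 xi1 x xs th ->
  dfal_bounded Bx Bth x xs th -> (0 < k)%N ->
  norm2 (A *m stack (x k)) <= lam_ c lam1 k * (2 * Bth).
Proof.
move=> c0 l0 [_ xP] xB k0; have [_ _ thS] := xP k k0.
have lk : 0 < lam_ c lam1 k by exact: geometric_from1_gt0.
have -> : A *m stack (x k) = lam_ c lam1 k *: (th k - th k.+1).
  by rewrite thS opprB addrC subrK scalerA mulfV ?gt_eqF// scale1r.
rewrite norm2Z gtr0_norm// ler_pM2l// (le_trans (norm2B _ _))//.
by rewrite mulr_natl mulr2n lerD//; [case: (xB k k0)|case: (xB k.+1 isT)].
Qed.

Lemma constant_residual0 (R : realType) (N n : nat) (e : rel 'I_N)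
    (A : 'M[R]_(N.-1 * n, N * n)) (x0 : 'rV[R]_n) :
  is_constraint_matrix e A -> A *m stack (\matrix_(i, j) x0 0 j) = 0.
Proof.
move=> hA; apply: norm2_eq0; rewrite (norm2_constraint _ hA).
rewrite (_ : _ *m _ = 0) ?norm2_0//; apply/matrixP => k j; rewrite !mxE.
under eq_bigr => i _ do rewrite !mxE mulrBl !(eq_sym i).
by rewrite sumrB !sum_indicator subrr.
Qed.

(** The augmented Lagrangian at the iterate is compared, through the minimizer
    [xs k], with its value at a consensus optimum; the penalty term at the
    iterate is nonnegative and dropped. *)
Lemma dfal_objective_le (R : realType) (N n : nat) (e : rel 'I_N)
    (A : 'M[R]_(N.-1 * n, N * n)) (rho gamma : 'I_N -> 'rV[R]_n -> R)
    (c lam1 alpha1 xi1 Bx Bth Fstar : R) (x xs : nat -> 'M[R]_(N, n)) th k :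
  (forall i, jensen (gamma i)) ->
  (forall i x, differentiable (gamma i : 'rV[R]_n -> R^o) x) ->
  is_min (common_obj rho gamma) Fstar -> is_constraint_matrix e A ->
  0 < c -> 0 < lam1 -> 0 < alpha1 -> 0 < xi1 -> 0 < Bx ->
  dfal A rho gamma c lam1 alpha1 xi1 x xs th ->
  dfal_bounded Bx Bth x xs th -> (0 < k)%N ->
  sum_obj rho gamma (x k) - Fstar <=
    2^-1 * lam_ c lam1 k * Bth ^+ 2 +
    (alpha_ c alpha1 k + N%:R * (2 * Bx) * xi_ c xi1 k) / lam_ c lam1 k.
Proof.
move=> cg dg [x0 _ FE] hA c0 l0 a0 xi0 B0 [_ xP] xB k0.
have [xsmin xgap _] := xP k k0; have [xBx thB] := xB k k0.
move: xBx; rewrite ge_max => /andP[xsB xkB].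
have lk : 0 < lam_ c lam1 k by exact: geometric_from1_gt0.
have ak : 0 < alpha_ c alpha1 k by rewrite geometric_from1_gt0// exprn_gt0.
have xik : 0 < xi_ c xi1 k by rewrite geometric_from1_gt0// exprn_gt0.
move: lk ak xik xsmin xgap thB.
move: (lam_ c lam1 k) (alpha_ c alpha1 k) (xi_ c xi1 k) => l a xi lk ak xik.
move=> xsmin xgap thB.
have NBxi : 0 <= N%:R * (2 * Bx) * xi by rewrite !mulr_ge0// ltW.
have gap : aug_lagrangian A rho gamma l (th k) (x k) -
    aug_lagrangian A rho gamma l (th k) (xs k) <= a + N%:R * (2 * Bx) * xi.
  case: xgap => [xgap|xgap]; first by rewrite (le_trans xgap)// lerDl.
  rewrite (le_trans (small_subgradient_gap cg dg _ _ xkB xsB xgap)) ?ltW//.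
  by rewrite ltrDr.
have augE z : aug_lagrangian A rho gamma l (th k) z =
    l * sum_obj rho gamma z + 2^-1 * norm2 (A *m stack z - l *: th k) ^+ 2.
  by rewrite /aug_lagrangian /smooth_part /sum_obj big_split/= mulrDr addrA.
have := xsmin (\matrix_(i, j) x0 0 j).
rewrite [X in _ <= X]augE (constant_residual0 _ hA) sub0r norm2N norm2Z.
have -> : sum_obj rho gamma (\matrix_(i, j) x0 0 j) = Fstar.
  rewrite FE; apply: eq_bigr => i _.
  by rewrite (_ : row i _ = x0)//; apply/matrixP => a' j; rewrite !mxE ord1.
rewrite gtr0_norm// exprMn => xsle.
have thB2 : norm2 (th k) ^+ 2 <= Bth ^+ 2.
  by rewrite ler_pXn2r ?nnegrE ?norm2_ge0// (le_trans _ thB)// norm2_ge0.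
rewrite -(ler_pM2l lk) [leRHS]mulrDr [X in _ <= _ + X]mulrC divfK ?gt_eqF//.
move: gap; rewrite [X in X - _]augE => gap.
have := sqr_ge0 (norm2 (A *m stack (x k) - l *: th k)) => sq.
have : l ^+ 2 * norm2 (th k) ^+ 2 <= l ^+ 2 * Bth ^+ 2.
  by rewrite ler_wpM2l// sqr_ge0.
have -> : l * (2^-1 * l * Bth ^+ 2) = 2^-1 * (l ^+ 2 * Bth ^+ 2) by ring.
rewrite mulrBr; move: gap xsle sq.
move: (l ^+ 2 * _) (l ^+ 2 * _) (l * _) (l * _) (N%:R * _ * _).
by move: (norm2 _ ^+ 2) (aug_lagrangian _ _ _ _ _ _) => *; lra.
Qed.

(** The summands of the objective, shifted by their lower bounds, are convex
    and nonnegative, hence Lipschitz at the points of a bounded set. *)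
Lemma sum_obj_lower_bound (R : realType) (N n : nat)
    (rho gamma : 'I_N -> 'rV[R]_n -> R) (glow : 'I_N -> R) (Fstar r : R) :
  (0 < N)%N -> (forall i, jensen (rho i)) -> (forall i, jensen (gamma i)) ->
  (forall i z, 0 <= rho i z) -> (forall i z, glow i <= gamma i z) ->
  is_min (common_obj rho gamma) Fstar ->
  exists2 M : R, 0 <= M & forall (x : 'M[R]_(N, n)) d, norm2 x <= r ->
    (forall i j, norm2 (row i x - row j x) <= d) ->
    Fstar - sum_obj rho gamma x <= M * d.
Proof.
move=> N0 cr cg r0 g0 [x0 Fmin FE]; pose i0 := Ordinal N0.
have lip i : {M | 0 <= M & forall y z, norm2 z <= r ->
    (rho i z + gamma i z) - (rho i y + gamma i y) <= M * norm2 (z - y)}.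
  apply: cid2.
  have [||M M0 ML] := @jensen_lipschitz_on_ball R n
      (fun z => rho i z + (gamma i z + - glow i)) r.
  - apply: jensenD => //; apply: jensenD => // t u v t01.
    by rewrite -mulrDl subrKC mul1r.
  - by move=> z; rewrite addr_ge0// subr_ge0.
  by exists M => // y z zr; have := ML y z zr; lra.
exists (\sum_i s2val (lip i)).
  by apply: sumr_ge0 => i _; exact: s2valP (lip i).
move=> x d xr xd; rewrite mulr_suml.
have := Fmin (row i0 x); rewrite -FE => Fle.
apply: (@le_trans _ _ (common_obj rho gamma (row i0 x) - sum_obj rho gamma x)).
  by rewrite lerD2r.
rewrite /common_obj /sum_obj -sumrB; apply: ler_sum => i _.
have M0 := s2valP (lip i).
apply: (le_trans (s2valP' (lip i) _ _ _)).
  by rewrite (le_trans (norm2_row_le _ _)).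
by rewrite ler_wpM2l.
Qed.

(** [M] is chosen before the graph and the constraint matrix: this is what makes
    the constant in the number of communications independent of the graph. *)
Lemma dfal_rate (R : realType) (N n : nat)
    (rho gamma : 'I_N -> 'rV[R]_n -> R) (glow : 'I_N -> R)
    (Fstar c lam1 alpha1 xi1 Bx Bth : R) :
  (0 < N)%N -> (forall i, jensen (rho i)) -> (forall i, jensen (gamma i)) ->
  (forall i z, 0 <= rho i z) -> (forall i z, glow i <= gamma i z) ->
  (forall i x, differentiable (gamma i : 'rV[R]_n -> R^o) x) ->
  is_min (common_obj rho gamma) Fstar ->
  0 < c -> 0 < lam1 -> 0 < alpha1 -> 0 < xi1 -> 0 < Bx -> 0 < Bth ->
  exists2 M : R, 0 < M &
  forall (e : rel 'I_N) (A : 'M[R]_(N.-1 * n, N * n)) x xs th k,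
    connected_graph e -> is_constraint_matrix e A ->
    dfal A rho gamma c lam1 alpha1 xi1 x xs th ->
    dfal_bounded Bx Bth x xs th ->
    `|sum_obj rho gamma (x k.+1) - Fstar| <= M * c ^+ k /\
    eps_feasible e (M * c ^+ k) (x k.+1).
Proof.
move=> N0 cr cg r0 g0 dg hF c0 l0 a0 xi0 B0 Bt0.
have [Ml Ml0 MlP] := sum_obj_lower_bound Bx N0 cr cg r0 g0 hF.
pose D := lam1 * (2 * Bth).
have D0 : 0 < D by rewrite !mulr_gt0.
pose T := 2^-1 * lam1 * Bth ^+ 2 + (alpha1 + N%:R * (2 * Bx) * xi1) / lam1.
have T0 : 0 <= T.
  by rewrite addr_ge0// ?mulr_ge0 ?sqr_ge0 ?addr_ge0 ?invr_ge0 ?mulr_ge0// ltW.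
have MND : 0 <= Ml * (N%:R * D) by rewrite !mulr_ge0// ltW.
exists (Ml * (N%:R * D) + T + D); first exact: ltr_wpDl (addr_ge0 MND T0) D0.
move=> e A x xs th k ce hA hx xB; have ck : 0 < c ^+ k by rewrite exprn_gt0.
have feas : eps_feasible e (D * c ^+ k) (x k.+1).
  move=> i j eij; apply: (le_trans (edge_le_constraint _ ce hA eij)).
  apply: (le_trans (dfal_residual_le c0 l0 hx xB _)) => //.
  by rewrite /lam_ geometric_from1E -mulrA mulrC.
split; last first.
  move=> i j /feas /le_trans; apply.
  by rewrite ler_wpM2r ?(ltW ck)// lerDr addr_ge0.
have [xkB _] := xB k.+1 isT; move: xkB; rewrite ge_max => /andP[_ xkB].
have Dc : 0 <= D * c ^+ k by rewrite ltW// mulr_gt0.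
have lower := MlP (x k.+1) _ xkB
  (fun i j => @consensus_gap_le _ _ _ _ _ _ i j ce feas Dc).
have upper := dfal_objective_le cg dg hF hA c0 l0 a0 xi0 B0 hx xB
  (ltn0Sn k).
have upper' : sum_obj rho gamma (x k.+1) - Fstar <= T * c ^+ k.
  apply: (le_trans upper).
  rewrite /lam_ /alpha_ /xi_ !geometric_from1E -exprM mulnC exprM.
  rewrite le_eqVlt; apply/orP; left; apply/eqP; rewrite /T.
  by field; rewrite !gt_eqF.
have Tc : 0 <= T * c ^+ k by rewrite mulr_ge0// ltW.
have Mc : 0 <= Ml * (N%:R * D) * c ^+ k by rewrite mulr_ge0// ltW.
have lower' : Fstar - sum_obj rho gamma (x k.+1) <= Ml * (N%:R * D) * c ^+ k.
  by apply: (le_trans lower); rewrite !mulrA.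
rewrite (mulrDl (_ + T)) (mulrDl (Ml * _)) ler_norml.
move: Dc Tc Mc lower' upper'.
move: (D * c ^+ k) (T * c ^+ k) (Ml * _ * c ^+ k) (sum_obj _ _ _).
by move=> *; apply/andP; split; lra.
Qed.

(** * Counting iterations *)

(** For the least such [K], if [K > 0], the exponent [K - 1] violates the first
    inequality, whence the second one. *)
Lemma geometric_hitting_time (R : realType) (c M eps : R) :
  0 < c < 1 -> 0 < M -> 0 < eps ->
  exists2 K, M * c ^+ K <= eps &
    eps <= 1 -> c^-1 ^+ K <= (1 + M / c) / eps.
Proof.
move=> /andP[c0 c1] M0 eps0.
have exK : exists K, M * c ^+ K <= eps.
  have c_lt1 : `|c| < 1 by rewrite gtr0_norm.
  have /cvgrPdist_le /(_ (eps / M)) := cvg_expr c_lt1.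
  rewrite divr_gt0// => /(_ isT) [K _ /(_ K (leqnn K))] /=.
  rewrite sub0r normrN ger0_norm ?exprn_ge0 ?(ltW c0)// => cK.
  by exists K; rewrite mulrC -ler_pdivlMr.
case: (ex_minnP exK) => K cK Kmin; exists K => //.
case: K cK Kmin => [|K] cK Kmin.
  move=> eps1; rewrite expr0 ler_pdivlMr// mul1r (le_trans eps1)// lerDl.
  by rewrite divr_ge0 ?ltW.
have : eps < M * c ^+ K.
  by rewrite ltNge; apply/negP => /Kmin; rewrite ltnn.
move=> epsK _; rewrite ler_pdivlMr// exprVn.
rewrite ler_pdivrMl ?exprn_gt0// exprS.
apply: (le_trans (ltW epsK)); rewrite -subr_ge0.
have -> : c * c ^+ K * (1 + M / c) - M * c ^+ K = c * c ^+ K.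
  by field; rewrite gt_eqF.
by rewrite mulr_ge0 ?exprn_ge0 ?(ltW c0).
Qed.

(** For [eps <= 1 / 2] additive constants are absorbed by
    [ln (eps^-1) >= ln 2]. *)
Lemma log_iteration_bound (R : realType) (c D : R) : 0 < c < 1 -> 1 <= D ->
  exists2 C, 0 < C & forall K eps, 0 < eps <= 2^-1 -> c^-1 ^+ K <= D / eps ->
    K.+1%:R <= C * ln (eps^-1).
Proof.
move=> /andP[c0 c1] D1.
have l2 : 0 < ln (2 : R) by rewrite ln_gt0// ltr1n.
have lc : 0 < ln (c^-1) by rewrite ln_gt0// invf_gt1.
have D0 : 0 < D by exact: lt_le_trans D1.
have lD : 0 <= ln D by rewrite ln_ge0.
pose a : R := (ln 2)^-1; pose b : R := (ln c^-1)^-1.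
have a0 : 0 < a by rewrite invr_gt0.
have b0 : 0 < b by rewrite invr_gt0.
exists (a + (ln D * a + 1) * b).
  by rewrite addr_gt0// mulr_gt0// ltr_wpDl// mulr_ge0// ltW.
move=> K eps /andP[eps0 eps2] cK.
have e2 : 2 <= eps^-1 by rewrite -[leLHS]invrK lef_pV2// posrE invr_gt0.
have le2 : ln 2 <= ln (eps^-1) by rewrite ler_ln ?posrE ?invr_gt0.
have : ln (c^-1 ^+ K) <= ln (D / eps).
  by rewrite ler_ln ?posrE ?exprn_gt0 ?divr_gt0 ?invr_gt0.
rewrite lnXn ?invr_gt0// lnM ?posrE ?invr_gt0// => Kle.
have h1 : 1 <= a * ln (eps^-1) by rewrite mulrC ler_pdivlMr// mul1r.
have h2 : ln D <= ln D * (a * ln (eps^-1)) by rewrite ler_peMr.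
have h3 : K%:R <= (ln D * (a * ln (eps^-1)) + ln (eps^-1)) * b.
  rewrite ler_pdivlMr// mulr_natl (le_trans Kle)//.
  by rewrite lerD2r.
rewrite -natr1 mulrDl addrC lerD// (le_trans h3)//.
by rewrite le_eqVlt; apply/orP; left; apply/eqP; ring.
Qed.

(** The increasing powers of [c^-1] are dominated by the last one, from which
    they decrease geometrically backwards. *)
Lemma sum_geometric_inv_le (R : realType) (c : R) K : 0 < c < 1 ->
  \sum_(k < K.+1) c^-1 ^+ k <= c^-1 ^+ K / (1 - c).
Proof.
move=> /andP[c0 c1]; have c1' : 0 < 1 - c by rewrite subr_gt0.
elim: K => [|K IH].
  by rewrite big_ord1 expr0 mul1r invf_ge1// gerBl ltW.
rewrite big_ord_recr/= (le_trans (lerD IH (lexx _)))//.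
rewrite le_eqVlt; apply/orP; left; apply/eqP; rewrite exprS.
by field; rewrite !gt_eqF.
Qed.

(** Since [psi >= 1], each [lam_k L_i + psi] is at most [psi (lam1 L_i + 1)],
    and the 1 lost in rounding up is at most [sqrt psi * c^-1 ^+ k]. *)
Lemma max_inner_le (R : realType) (N : nat) (L : 'I_N -> R)
    (c lam1 alpha1 psi Bx : R) k :
  0 < c < 1 -> 0 < lam1 -> 0 < alpha1 -> 0 < Bx -> (forall i, 0 <= L i) ->
  1 <= psi ->
  (max_inner c lam1 alpha1 L psi Bx k.+1)%:R <=
    Num.sqrt psi * (Bx * Num.sqrt (2 * (\sum_i (lam1 * L i + 1)) / alpha1) + 1)
    * c^-1 ^+ k.
Proof.
move=> /andP[c0 c1] l0 a0 B0 L0 psi1; rewrite /max_inner.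
have psi0 : 0 <= psi by rewrite (le_trans _ psi1).
have psiS : 1 <= Num.sqrt psi by rewrite -[leLHS]sqrtr1 ler_wsqrtr.
have cVk : 1 <= c^-1 ^+ k by rewrite exprn_ege1// invf_ge1// ltW.
set S := \sum_i (lam1 * L i + 1).
set X := Bx * Num.sqrt _.
have X0 : 0 <= X by rewrite mulr_ge0 ?sqrtr_ge0 ?ltW.
have : (`|Num.ceil X|%N)%:R <= X + 1.
  rewrite natr_absz ger0_norm; last first.
    by rewrite ceil_ge0 (lt_le_trans _ X0)// ltrN10.
  by have := ceilB1_lt X; rewrite intrB; lra.
move/le_trans; apply; rewrite -mulrA mulrDl mulrDr; apply: lerD; last first.
  by rewrite mul1r -[leLHS]mul1r ler_pM.
rewrite /X mulrCA -!mulrA ler_pM2l//.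
have S0 : 0 <= S by apply: sumr_ge0 => i _; rewrite addr_ge0// mulr_ge0// ltW.
have -> : Num.sqrt (2 * (S / alpha1)) * (Num.sqrt psi * c^-1 ^+ k) =
    Num.sqrt (2 * (S / alpha1) * (psi * (c^-1 ^+ k) ^+ 2)).
  rewrite [RHS]sqrtrM ?mulr_ge0 ?invr_ge0 ?(ltW a0)//.
  rewrite [Num.sqrt (psi * _)]sqrtrM// sqrtr_sqr ger0_norm//.
  by rewrite (le_trans _ cVk).
apply: ler_wsqrtr; rewrite /alpha_ geometric_from1E.
have -> : 2 * (S / alpha1) * (psi * (c^-1 ^+ k) ^+ 2) =
    2 * ((psi * S) / (c ^+ 2 ^+ k * alpha1)).
  rewrite (_ : (c^-1 ^+ k) ^+ 2 = (c ^+ 2 ^+ k)^-1).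
    by field; rewrite !gt_eqF ?exprn_gt0.
  by rewrite !exprVn -!exprM mulnC.
rewrite ler_pM2l// ler_wpM2r//.
  by rewrite invr_ge0 mulr_ge0 ?exprn_ge0 ?(ltW c0) ?(ltW a0).
rewrite mulr_sumr; apply: ler_sum => i _.
rewrite /block_lip mulrDr mulr1 lerD2r.
have lamk : lam_ c lam1 k.+1 <= lam1.
  rewrite /lam_ geometric_from1E ler_piMl ?(ltW l0)// exprn_ile1 ?ltW//.
rewrite -[leLHS]mul1r ler_pM// ?mulr_ge0 ?(ltW l0)//.
  by rewrite ltW// geometric_from1_gt0.
by rewrite ler_wpM2r.
Qed.

Lemma communications_le (R : realType) (ell m : nat -> nat) (D c : R) K :
  0 < c < 1 -> 0 <= D -> (forall k, (0 < k)%N -> (ell k <= m k)%N) ->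
  (forall k, (m k.+1)%:R <= D * c^-1 ^+ k) ->
  (communications ell K.+1)%:R <= D / (1 - c) * c^-1 ^+ K.
Proof.
move=> hc D0 ellm mD; rewrite /communications big_add1/= natr_sum big_mkord.
apply: (@le_trans _ _ (\sum_(k < K.+1) D * c^-1 ^+ k)).
  by apply: ler_sum => k _; rewrite (le_trans _ (mD k))// ler_nat ellm.
by rewrite -mulr_sumr mulrAC -mulrA ler_wpM2l// sum_geometric_inv_le.
Qed.

Lemma solved_by_msapg_le (R : realType) (N n m : nat) (A : 'M[R]_(m, N * n))
    (rho gamma : 'I_N -> 'rV[R]_n -> R) (c lam1 alpha1 xi1 : R)
    (L : 'I_N -> R) (psi Bx : R) x th ell k :
  solved_by_msapg A rho gamma c lam1 alpha1 xi1 L psi Bx x th ell ->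
  (0 < k)%N -> (ell k <= max_inner c lam1 alpha1 L psi Bx k)%N.
Proof.
move=> sol k0; have [y [yb [t [_ [[/andP[_ ?]]|[->]]]]]] := sol k k0.
  by [].
by rewrite leqnn.
Qed.

(** Raising the exponent of [psi] from 1/2 to 3/2 only increases the power, and
    the factor [N] compensates the division by [d]. *)
Lemma sqrt_le_cost_factor (R : realType) (N : nat) (psi : R) (d : nat) :
  1 <= psi -> (0 < d <= N)%N ->
  Num.sqrt psi <= N%:R * (psi `^ (3 / 2) / d%:R).
Proof.
move=> psi1 /andP[d0 dN]; have d0' : 0 < d%:R :> R by rewrite ltr0n.
have psi0 : 0 <= psi by rewrite (le_trans _ psi1).
rewrite mulrCA; apply: (@le_trans _ _ (psi `^ (3 / 2))).
  by rewrite -powR12_sqrt// ler_powR//; lra.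
by rewrite ler_peMr ?powR_ge0// ler_pdivlMr// mul1r ler_nat.
Qed.

(** [R^0] has a single point. *)
Lemma trivial_dimension (R : realType) (N : nat) (e : rel 'I_N)
    (rho gamma : 'I_N -> 'rV[R]_0 -> R) (Fstar eps : R) (x : 'M[R]_(N, 0)) :
  is_min (common_obj rho gamma) Fstar -> 0 < eps ->
  eps_optimal rho gamma Fstar eps x /\ eps_feasible e eps x.
Proof.
move=> [x0 _ ->] eps0; split; last first.
  by move=> i j _; rewrite [_ - _]thinmx0 norm2_0 ltW.
rewrite /eps_optimal (_ : sum_obj _ _ _ = common_obj rho gamma x0).
  by rewrite subrr normr0 ltW.
by apply: eq_bigr => i _; rewrite [row i x]thinmx0 [x0]thinmx0.
Qed.

Lemma eventually_optimal_cvg (R : realType) (N n : nat)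
    (rho gamma : 'I_N -> 'rV[R]_n -> R) (Fstar : R) (x : nat -> 'M[R]_(N, n)) :
  (forall eps, 0 < eps -> exists K, forall k, (K <= k)%N ->
    eps_optimal rho gamma Fstar eps (x k)) ->
  sum_obj rho gamma (x k) @[k --> \oo] --> Fstar.
Proof.
move=> H; apply/cvgrPdist_le => eps /H[K HK].
by near=> k; rewrite distrC; apply: HK; near: k; exact: nbhs_infty_ge.
Unshelve. all: by end_near.
Qed.

(** * Convergence and complexity of DFAL *)

(* Ccomm does not depend on eps, on the graph or on the run; C does not depend
   on eps or on the run. *)
Theorem mainTheorem1 (R : realType) (N n : nat) (hN : (1 < N)%N)
    (rho gamma : 'I_N -> 'rV[R]_n -> R) (L glow B tau : 'I_N -> R)
    (hgamma : forall i, in_Gamma (L i) (glow i) (gamma i))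
    (hrho : forall i, in_Rclass (B i) (tau i) (rho i))
    (Fstar : R) (hFstar : is_min (common_obj rho gamma) Fstar)
    (c lam1 alpha1 xi1 lambar Bx Bth : R)
    (hc : 0 < c < 1) (hlam1 : 0 < lam1) (halpha1 : 0 < alpha1)
    (hxi1 : 0 < xi1) (hlambar : 0 < lambar) (hBx : 0 < Bx) (hBth : 0 < Bth)
    (hlam : lam1 <= lambar) (hxi : forall i, xi1 / lam1 < tau i) :
  exists2 Ccomm : R, 0 < Ccomm &
  forall (e : rel 'I_N) (A : 'M[R]_(N.-1 * n, N * n)) (psi : R),
    connected_graph e -> is_constraint_matrix e A ->
    is_max_eigenvalue (laplacian R e) psi ->
    guarantees_bounds A rho gamma c lam1 alpha1 xi1 tau lambar Bx Bth ->
  exists2 C : R, 0 < C &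
  forall x xs th, dfal A rho gamma c lam1 alpha1 xi1 x xs th ->
    (sum_obj rho gamma (x k) @[k --> \oo] --> Fstar) /\
    forall eps : R, 0 < eps ->
    exists K : nat,
      [/\ forall k, (K <= k)%N ->
            eps_optimal rho gamma Fstar eps (x k) /\ eps_feasible e eps (x k),
          eps <= 2^-1 -> K%:R <= C * ln (eps^-1)
        & forall ell : nat -> nat,
            solved_by_msapg A rho gamma c lam1 alpha1 xi1 L psi Bx x th ell ->
            eps <= 2^-1 ->
            [/\ (communications ell K)%:R <=
                  Ccomm * (psi `^ (3 / 2) / (min_degree e)%:R) * eps^-1,
                (gradient_evals ell K)%:R <= C * eps^-1
              & (prox_evals ell K)%:R <= C * eps^-1]].
Proof.
have N0 : (0 < N)%N := ltnW hN.
have [c0 c1] := andP hc.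
(* n = 0 is treated apart because the empty matrix A gives no bound on psi;
   every point is then optimal and feasible, so K = 0 works *)
have [n0|n0] := posnP n.
  move: rho gamma hgamma hrho hFstar; rewrite n0 => rho gamma _ _ hFstar.
  exists 1 => // e A psi _ _ _ _; exists 1 => // x xs th _; split.
    apply: eventually_optimal_cvg => eps eps0; exists 0%N => k _.
    by have [] := trivial_dimension e (x k) hFstar eps0.
  move=> eps eps0; exists 0%N; split.
  - by move=> k _; exact: trivial_dimension.
  - move=> eps2; rewrite mul1r ln_ge0// invf_ge1// (le_trans eps2)//.
    by rewrite invf_le1// ler1n.
  - move=> ell _ _.
    rewrite /gradient_evals /prox_evals /communications big_geq//.
    by rewrite !mul1r !mulr_ge0 ?powR_ge0 ?invr_ge0 ?(ltW eps0).
have cr i : jensen (rho i).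
  by have [/convex_function_jensen] := hrho i.
have cg i : jensen (gamma i).
  by have [/convex_function_jensen] := hgamma i.
have dg i : forall x, differentiable (gamma i : 'rV[R]_n -> R^o) x.
  by have [] := hgamma i.
have r0 i z : 0 <= rho i z.
  have [_ _ [t0 /(_ z)]] := hrho i; apply: le_trans.
  by rewrite mulr_ge0 ?norm2_ge0 ?ltW.
have g0 i : forall z, glow i <= gamma i z by have [] := hgamma i.
have L0 i : 0 <= L i by have [_ _ []] := hgamma i.
have [M M0 rate] := dfal_rate N0 cr cg r0 g0 dg hFstar c0 hlam1 halpha1 hxi1
  hBx hBth.
pose D := 1 + M / c.
have D1 : 1 <= D by rewrite lerDl divr_ge0 ?ltW.
have D0 : 0 < D by exact: lt_le_trans D1.
have [C1 C10 C1P] := log_iteration_bound hc D1.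
pose D2 := Bx * Num.sqrt (2 * (\sum_i (lam1 * L i + 1)) / alpha1) + 1.
have D20 : 0 < D2 by rewrite ltr_wpDl// mulr_ge0 ?sqrtr_ge0 ?ltW.
pose Ccomm := D2 / (1 - c) * D * N%:R.
have c1' : 0 < 1 - c by rewrite subr_gt0.
have Ccomm0 : 0 < Ccomm by rewrite !mulr_gt0 ?invr_gt0 ?ltr0n.
exists Ccomm => // e A psi ce hA hpsi bnd.
have psi1 := max_eigenvalue_ge1 hN n0 ce hA hpsi.
pose F := psi `^ (3 / 2) / (min_degree e)%:R.
have F0 : 0 <= F by rewrite divr_ge0 ?powR_ge0.
exists (C1 + Ccomm * F); first exact: ltr_wpDr (mulr_ge0 (ltW Ccomm0) F0) C10.
move=> x xs th hx; have xB := bnd hlam hxi x xs th hx.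
suff main : forall eps : R, 0 < eps ->
    exists K : nat,
      [/\ forall k, (K <= k)%N ->
            eps_optimal rho gamma Fstar eps (x k) /\ eps_feasible e eps (x k),
          eps <= 2^-1 -> K%:R <= C1 * ln (eps^-1)
        & forall ell : nat -> nat,
            solved_by_msapg A rho gamma c lam1 alpha1 xi1 L psi Bx x th ell ->
            eps <= 2^-1 -> (communications ell K)%:R <= Ccomm * F * eps^-1].
  split.
    apply: eventually_optimal_cvg => eps /main[K [HK _ _]].
    by exists K => k /HK[].
  move=> eps eps0; have [K [HK K1 K2]] := main eps eps0; exists K; split=> //.
    move=> eps2; rewrite (le_trans (K1 eps2))// ler_wpM2r//.
      rewrite ln_ge0// invf_ge1// (le_trans eps2)//.
      by rewrite invf_le1// ler1n.
    by rewrite lerDl; exact: mulr_ge0 (ltW Ccomm0) F0.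
  move=> ell sol eps2; have comm := K2 ell sol eps2.
  have comm' : (communications ell K)%:R <= (C1 + Ccomm * F) * eps^-1.
    rewrite (le_trans comm)// ler_wpM2r ?invr_ge0 ?(ltW eps0)//.
    by rewrite lerDr ltW.
  by split.
move=> eps eps0; have [K MK cK] := geometric_hitting_time hc M0 eps0.
have le1 : eps <= 2^-1 -> eps <= 1.
  by move/le_trans; apply; rewrite invf_le1// ler1n.
(* the sequences are indexed from 1, so iterate K.+1 has accuracy M c ^ K *)
exists K.+1; split.
- move=> [//|k] Kk; have [opt feas] := rate e A x xs th k ce hA hx xB.
  have Mk : M * c ^+ k <= eps.
    rewrite (le_trans _ MK)// ler_pM2l//.
    by apply: ler_wiXn2l; rewrite ?(ltW c0) ?(ltW c1).
  split; first by rewrite /eps_optimal (le_trans opt).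
  by move=> i j /feas /le_trans; exact.
- by move=> eps2; apply: C1P; rewrite ?eps0// cK// le1.
- move=> ell sol eps2.
  have sq0 : 0 <= Num.sqrt psi * D2 := mulr_ge0 (sqrtr_ge0 _) (ltW D20).
  apply: (le_trans (communications_le K hc sq0
    (fun k k0 => solved_by_msapg_le sol k0)
    (fun k => max_inner_le k hc hlam1 halpha1 hBx L0 psi1))).
  have sqF := sqrt_le_cost_factor psi1 (min_degree_bounds hN ce).
  apply: (@le_trans _ _ (Num.sqrt psi * D2 / (1 - c) * (D / eps))).
    by rewrite ler_wpM2l ?cK ?le1// divr_ge0// ltW.
  have -> : Num.sqrt psi * D2 / (1 - c) * (D / eps) =
      Num.sqrt psi * (D2 / (1 - c) * D / eps) by ring.
  have -> : Ccomm * F * eps^-1 = N%:R * F * (D2 / (1 - c) * D / eps).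
    by rewrite /Ccomm; ring.
  by rewrite ler_wpM2r// !mulr_ge0 ?invr_ge0 ?(ltW c1') ?(ltW eps0) ?ltW.
Qed.
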